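(* Let $(S_n)_{n\ge0}$ be an irreducible and aperiodic Markov chain on a countable state space. For states $x,y$ and $N\ge1$ let $a_N(x,y)=G_N(x,x)-G_N(y,x)\ge 0$. Then, for any two fixed points $x\ne y$, the following limit exists and satisfies $$\lim_{N\to+\infty}\bigl(a_N(x,y)+\alpha(x,y)\,a_N(y,x)\bigr)=\mathbb{E}_x\left(\sum_{n=0}^{T_y-1}1_{S_n=x}\right)+1_{TR}\,G(x,x)\,P_x(T_y=\infty)\,P_y(T_x=\infty),$$ where $$\alpha(x,y)=\frac{\mathbb{E}_x\left(\sum_{0\le n<T_y}1_{S_n=x}\right)}{\mathbb{E}_y\left(\sum_{0\le n<T_x}1_{S_n=y}\right)}.$$
   Context: $P_x,\mathbb{E}_x$ denote probability and expectation for the chain started at $x$. $T_y=\min\{n\ge1:\ S_n=y\}$ (equal to $+\infty$ if there is no such $n$). $G(x,y)=\mathbb{E}_x(\sum_{n\ge0}1_{S_n=y})$ and $G_N(x,y)=\mathbb{E}_x(\sum_{0\le n<N}1_{S_n=y})$ for $N\ge1$. $1_{TR}$ equals $1$ if the chain is transient and $0$ if it is recurrent; in the recurrent case the term containing $1_{TR}$ is understood to be $0$. *)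

(* Defs.v *)
From HB Require Import structures.
From mathcomp Require Import all_boot all_order all_algebra.
From mathcomp Require Import all_classical all_reals all_analysis.
Set Implicit Arguments.
Unset Strict Implicit.
Unset Printing Implicit Defensive.
Import Order.TTheory GRing.Theory Num.Theory.
Local Open Scope classical_set_scope.
Local Open Scope ring_scope.
Local Open Scope ereal_scope.

Section MarkovChain.
Context {R : realType} {I : countType} {d : measure_display}
  {Om : measurableType d}.
(* [S n w] is the position at time n along the trajectory w, and [P x] is the
   law of the chain started at x. *)
Variables (P : I -> probability Om R) (S : nat -> Om -> I).

(* Time-homogeneous Markov chain with transition matrix p.  The Markov property
   P_x(S_{n+1} = i_{n+1} | S_0 = i_0, ..., S_n = i_n) = p(i_n, i_{n+1}) is
   written in product form, which is meaningful even when the conditioning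
   event is negligible. *)
Record is_markov_chain (p : I -> I -> R) : Prop := IsMarkovChain {
  trans_ge0 : forall x y, (0 <= p x y)%R ;
  trans_sum1 : forall x, \esum_(y in [set: I]) (p x y)%:E = 1 ;
  chain_measurable : forall n y, measurable [set w | S n w = y] ;
  chain_start : forall x, P x [set w | S 0%N w = x] = 1 ;
  chain_step : forall x n (i : nat -> I),
    P x [set w | forall k, (k <= n.+1)%N -> S k w = i k] =
    P x [set w | forall k, (k <= n)%N -> S k w = i k] * (p (i n) (i n.+1))%:E
}.

Definition irreducible : Prop :=
  forall x y, exists n, 0 < P x [set w | S n w = y].

Definition return_times (x : I) : set nat :=
  [set n | (0 < n)%N /\ 0 < P x [set w | S n w = x]].

Definition is_set_gcd (A : set nat) (g : nat) : Prop :=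
  (forall n, A n -> (g %| n)%N) /\
  (forall e, (forall n, A n -> (e %| n)%N) -> (e %| g)%N).

Definition aperiodic : Prop := forall x, is_set_gcd (return_times x) 1.

Definition hit (y : I) (w : Om) : \bar R :=
  match pselect (exists n, (1 <= n)%N && (S n w == y)) with
  | left h => (ex_minn h)%:R%:E
  | right _ => +oo
  end.

Definition transient : Prop := forall x, P x [set w | hit x w < +oo] < 1.

Definition ind_transient : \bar R := if `[< transient >] then 1 else 0.

Definition green (x y : I) : \bar R :=
  \int[P x]_w \sum_(0 <= n <oo) ((S n w == y)%:R)%:E.

Definition greenN (N : nat) (x y : I) : \bar R :=
  \int[P x]_w \sum_(0 <= n < N) ((S n w == y)%:R)%:E.

(* E_x (sum_{0 <= n < T_y} 1_{S_n = x}); the sum runs over all n if T_y = +oo. *)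
Definition visits_before (x y : I) : \bar R :=
  \int[P x]_w \sum_(0 <= n <oo | (n%:R%:E < hit y w)) ((S n w == x)%:R)%:E.

Definition pot (N : nat) (x y : I) : \bar R := greenN N x x - greenN N y x.

Definition alpha (x y : I) : \bar R := visits_before x y / visits_before y x.

(* In the recurrent case the second term is 0, since 0 * +oo = 0 in \bar R. *)
Definition limit_value (x y : I) : \bar R :=
  visits_before x y +
  ind_transient * green x x * P x [set w | hit y w = +oo]
    * P y [set w | hit x w = +oo].

End MarkovChain.

(* Main.v *)
Require Import Defs.
From HB Require Import structures.
From mathcomp Require Import all_boot all_order all_algebra.
From mathcomp Require Import all_classical all_reals all_analysis.
From mathcomp Require Import measurable_realfun ring lra zify.
Import Order.TTheory GRing.Theory Num.Theory.
Import numFieldNormedType.Exports.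
Set Implicit Arguments.
Unset Strict Implicit.
Unset Printing Implicit Defensive.
Local Open Scope classical_set_scope.
Local Open Scope ring_scope.

(** Write [p_xx], [p_yx] for the sequences of n-step transition probabilities,
    [f], [g] for the laws of T_y under P_x and of T_x under P_y, and [v_x] for
    the sequence P_x(S_n = x, n < T_y); products of sequences are convolutions
    and [E] is the constant sequence 1.  Decomposing at first passages gives
    [p_yx = g p_xx] and [p_xx = v_x + f p_yx], so that [a = E (p_xx - p_yx)]
    and its mirror image [b] are nonnegative, bounded, and satisfy
    [v_y a + v_x g b = E v_x v_y].  If the chain is transient all the series
    converge and the limit is computed from their sums.  If it is recurrent,
    [a - f_xx a = E (1 - g)] tends to 0, where [f_xx] is the law of the return
    time to x, a probability on the integers with span 1; a bounded solution
    of such a renewal equation satisfies [a (n + 1) - a n -> 0] by a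
    Choquet-Deny argument.  Hence [v_y a] is asymptotic to [V_y a] and
    [v_x g b] to [V_x b], where [V_x] and [V_y] are the sums of [v_x] and
    [v_y], and [V_y a + V_x b] tends to [V_x V_y]. *)

(** * Sequences under convolution *)

(* An alias is needed because [nat -> R] already carries the pointwise ring
   structure; [fps R] gets the convolution product. *)
Definition fps (R : Type) := nat -> R.

Section FpsRing.
Context {R : comNzRingType}.
Implicit Types u v w : fps R.

HB.instance Definition _ := gen_eqMixin (fps R).
HB.instance Definition _ := gen_choiceMixin (fps R).

Definition fps_add u v : fps R := fun n => u n + v n.
Definition fps_opp u : fps R := fun n => - u n.
Definition fps_zero : fps R := fun=> 0.

Fact fps_addA : associative fps_add.
Proof. by move=> u v w; apply/funext => n; rewrite /fps_add addrA. Qed.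
Fact fps_addC : commutative fps_add.
Proof. by move=> u v; apply/funext => n; rewrite /fps_add addrC. Qed.
Fact fps_add0 : left_id fps_zero fps_add.
Proof. by move=> u; apply/funext => n; rewrite /fps_add add0r. Qed.
Fact fps_addN : left_inverse fps_zero fps_opp fps_add.
Proof. by move=> u; apply/funext => n; rewrite /fps_add addNr. Qed.

HB.instance Definition _ :=
  GRing.isZmodule.Build (fps R) fps_addA fps_addC fps_add0 fps_addN.

Definition fps_mul u v : fps R := fun n => \sum_(k < n.+1) u k * v (n - k)%N.
Definition fps_one : fps R := fun n => (n == 0)%:R.

Let trunc N u : {poly R} := \poly_(k < N) u k.

Let coef_truncM N u v n : (n < N)%N -> (trunc N u * trunc N v)`_n = fps_mul u v n.
Proof.
move=> nN; rewrite coefM; apply: eq_bigr => k _; rewrite !coef_poly.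
by rewrite (leq_ltn_trans _ nN) ?leq_ord // (leq_ltn_trans (leq_subr _ _) nN).
Qed.

Fact fps_mulC : commutative fps_mul.
Proof.
by move=> u v; apply/funext => n; rewrite -!(@coef_truncM n.+1) // mulrC.
Qed.

(* A coefficient of a product only depends on truncations of the factors, so
   the ring laws are inherited from polynomials. *)
Fact fps_mulA : associative fps_mul.
Proof.
have mulE u v w n : fps_mul (fps_mul u v) w n =
    (trunc n.+1 u * trunc n.+1 v * trunc n.+1 w)`_n.
  rewrite coefM; apply: eq_bigr => k _; rewrite coef_truncM ?ltn_ord //.
  by rewrite coef_poly ltnS leq_subr.
by move=> u v w; apply/funext => n; rewrite fps_mulC !mulE mulrC mulrA.
Qed.

Fact fps_mul1 : left_id fps_one fps_mul.
Proof.
move=> u; apply/funext => n; rewrite /fps_mul big_ord_recl /= subn0 mul1r.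
by rewrite big1 ?addr0 // => k _; rewrite mul0r.
Qed.

Fact fps_mulDl : left_distributive fps_mul fps_add.
Proof.
move=> u v w; apply/funext => n; rewrite /fps_mul /fps_add -big_split /=.
by apply: eq_bigr => k _; rewrite mulrDl.
Qed.

Fact fps_one_neq0 : fps_one != fps_zero.
Proof. by apply/eqP => /(congr1 (@^~ 0)) /eqP; rewrite oner_eq0. Qed.

HB.instance Definition _ := GRing.Zmodule_isComNzRing.Build (fps R)
  fps_mulA fps_mulC fps_mul1 fps_mulDl fps_one_neq0.

Lemma fpsDE u v n : (u + v : fps R) n = u n + v n. Proof. by []. Qed.
Lemma fpsNE u n : (- u : fps R) n = - u n. Proof. by []. Qed.
Lemma fpsBE u v n : (u - v : fps R) n = u n - v n. Proof. by []. Qed.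
Lemma fps1E n : (1 : fps R) n = (n == 0)%:R. Proof. by []. Qed.
Lemma fpsME u v n : (u * v : fps R) n = \sum_(k < n.+1) u k * v (n - k)%N.
Proof. by []. Qed.

Definition fps_ones : fps R := fun=> 1.

(** [series u n] sums the indices below [n], so coefficient [n] of the product is the partial sum up
    to [n.+1]; hence the shifts by one in later limits. *)
Lemma fps_onesM u n : (fps_ones * u : fps R) n = series u n.+1.
Proof.
rewrite mulrC fpsME seriesEord; apply: eq_bigr => k _.
by rewrite mulr1.
Qed.

Definition fps_monom k : fps R := fun n => (n == k)%:R.

Lemma fps_monomM k u n :
  (fps_monom k * u : fps R) n = if (k <= n)%N then u (n - k)%N else 0.
Proof.
rewrite fpsME; case: leqP => kn.
  rewrite (bigD1 (Ordinal (kn : (k < n.+1)%N))) //= /fps_monom eqxx mul1r.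
  rewrite big1 ?addr0 // => j /negbTE jk.
  by rewrite (_ : (j : nat) == k = false) ?mul0r // -[RHS]jk.
rewrite big1 // => j _; rewrite /fps_monom (_ : (j : nat) == k = false) ?mul0r //.
by apply/negbTE; rewrite neq_ltn (leq_ltn_trans _ kn) // -ltnS ltn_ord.
Qed.

End FpsRing.

(** * Limits of convolutions with a nonnegative summable sequence *)

Section NonnegativeConvolution.
Context {R : realType}.
Implicit Types (u v f c : fps R) (s l C : R).

Lemma nneg_series_le u s n : (forall k, 0 <= u k) ->
  series u n @[n --> \oo] --> s -> series u n <= s.
Proof.
move=> u0 us; rewrite -(cvg_lim _ us) //.
apply: nondecreasing_cvgn_le; last by apply/cvg_ex; exists s.
by apply: nondecreasing_series => k _ _; exact: u0.
Qed.

Lemma nneg_series_cvg u C : (forall k, 0 <= u k) ->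
  (forall n, series u n <= C) -> exists s, series u n @[n --> \oo] --> s.
Proof.
move=> u0 uC; apply/cvg_ex; apply: nondecreasing_is_cvgn.
  by apply: nondecreasing_series => k _ _; exact: u0.
by exists C => _ [n _ <-].
Qed.

(** Dominated convergence for sums: beyond some [K] the tail of [u] times [C] is small uniformly in
    [n], and the head is a fixed finite sum of null sequences. *)
Lemma triangular_sum_cvg0 u (h : nat -> nat -> R) s C :
  (forall k, 0 <= u k) -> series u n @[n --> \oo] --> s ->
  (forall n k, `|h n k| <= C) -> (forall k, h n k @[n --> \oo] --> 0) ->
  \sum_(k < n.+1) u k * h n k @[n --> \oo] --> (0 : R).
Proof.
move=> u0 us hC h0; apply/cvgr0Pnorm_le => e e0.
have C0 : 0 <= C by apply: le_trans (hC 0 0)%N.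
(* The divisor is [C + 1] because [C] may be 0. *)
have [K _ /(_ _ (leqnn K)) sK] : \forall n \near \oo, `|s - series u n| <= e / 2 / (C + 1).
  by move/cvgrPdist_le : us; apply; rewrite divr_gt0 ?divr_gt0 // ltr_wpDl.
have := nneg_series_le _ u0 us => us_le.
have hK : \sum_(0 <= k < K) u k * `|h n k| @[n --> \oo] --> (0 : R).
  rewrite [X in _ --> X](_ : _ = \sum_(0 <= k < K) u k * `|0 : R|); last first.
    by rewrite big1 // => k _; rewrite normr0 mulr0.
  apply: cvg_big => [|k _]; first exact: add_continuous.
  apply: cvgM; first exact: cvg_cst.
  by apply: cvg_norm; exact: h0.
have {}hK : \forall n \near \oo, `|\sum_(0 <= k < K) u k * `|h n k| | <= e / 2.
  by move/cvgr0Pnorm_le : hK; apply; rewrite divr_gt0.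
near=> n.
have Kn : (K <= n.+1)%N by near: n; exists K => // m /= Km; rewrite ltnW.
rewrite (le_trans (ler_norm_sum _ _ _)) //.
rewrite -(big_mkord xpredT (fun k => `|u k * h n k|)) (big_cat_nat (leq0n K) Kn) /=.
rewrite [e]splitr lerD //.
  have : `|\sum_(0 <= k < K) u k * `|h n k| | <= e / 2 by near: n.
  move/(le_trans (ler_norm _)); apply: le_trans; apply: ler_sum => k _.
  by rewrite normrM ger0_norm.
apply: (@le_trans _ _ (C * (series u n.+1 - series u K))).
  rewrite sub_series Kn mulr_sumr; apply: ler_sum => k _.
  by rewrite normrM ger0_norm // mulrC ler_wpM2r.
apply: (@le_trans _ _ (C * (e / 2 / (C + 1)))).
  rewrite ler_wpM2l // (le_trans _ sK) // (le_trans _ (ler_norm _)) //.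
  by rewrite lerD2r us_le.
rewrite mulrCA -[leRHS]mulr1 ler_wpM2l ?divr_ge0 ?(ltW e0) //.
by rewrite ler_pdivrMr ?ltr_wpDl // mul1r lerDl.
Unshelve. all: by end_near. Qed.

Lemma cvg_shift u l k : u n @[n --> \oo] --> l -> u (n - k)%N @[n --> \oo] --> l.
Proof. by rewrite -(cvg_centern k). Qed.

(** Writing [v] as [(v - l) + l], the first part gives a triangular sum tending to 0 and the second
    gives [l] times the partial sums of [u]. *)
Lemma fps_mul_cvg u v s l : (forall k, 0 <= u k) ->
  series u n @[n --> \oo] --> s -> v n @[n --> \oo] --> l ->
  (u * v) n @[n --> \oo] --> s * l.
Proof.
move=> u0 us vl.
have [C Cv] : exists C, forall n, `|v n - l| <= C.
  have : bounded_fun v by apply: cvg_seq_bounded; apply/cvg_ex; exists l.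
  move=> [M [_ /(_ (M + 1))]]; rewrite ltrDl ltr01 => /(_ erefl) Mv.
  exists (M + 1 + `|l|) => n; rewrite (le_trans (ler_normB _ _)) // lerD2r.
  exact: Mv.
have -> : (fun n => (u * v) n) =
    (fun n => \sum_(k < n.+1) u k * (v (n - k)%N - l) + series u n.+1 * l).
  apply/funext => n; rewrite fpsME seriesEord mulr_suml -big_split /=.
  by apply: eq_bigr => k _; rewrite -mulrDr subrK.
rewrite -[X in _ --> X]add0r; apply: cvgD; last first.
  by apply: cvgM; [rewrite cvg_shiftS | exact: cvg_cst].
apply: (triangular_sum_cvg0 (h := fun n k => v (n - k)%N - l) u0 us) => // k.
by rewrite -[X in _ --> X](subrr l); apply: cvgB; [exact: cvg_shift|exact: cvg_cst].
Qed.

(** Telescoping over [k] unit increments. Truncated subtraction makes the telescoping valid only for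
    large [n], hence the eventual equality. *)
Lemma slowly_varying_shift c k : c n.+1 - c n @[n --> \oo] --> (0 : R) ->
  c (n - k)%N - c n @[n --> \oo] --> (0 : R).
Proof.
move=> c1; elim: k => [|k IH].
  rewrite (_ : (fun _ => _) = cst 0); last by apply/funext => n; rewrite subn0 subrr.
  exact: cvg_cst.
have ck := cvg_shift k.+1 c1.
rewrite -[0]subr0; apply: cvg_trans (cvgB IH ck); apply: near_eq_cvg.
near=> n.
have kn : (k < n)%N by near: n; exists k.+1.
rewrite !fctE /= (_ : (n - k.+1).+1 = (n - k)%N); last by rewrite subnS prednK // subn_gt0.
by rewrite opprB addrC addrA subrK.
Unshelve. all: by end_near. Qed.

(** The sequence [c] may oscillate; summability of [u] concentrates the convolution on bounded lags,
    over which [c] hardly changes, so [c (n - k)] can be replaced by [c n]. *)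
Lemma fps_mul_slowly_varying u c s C : (forall k, 0 <= u k) ->
  series u n @[n --> \oo] --> s -> (forall n, `|c n| <= C) ->
  c n.+1 - c n @[n --> \oo] --> (0 : R) ->
  (u * c) n - s * c n @[n --> \oo] --> (0 : R).
Proof.
move=> u0 us cC c1.
have -> : (fun n => (u * c) n - s * c n) = (fun n =>
    \sum_(k < n.+1) u k * (c (n - k)%N - c n) + (series u n.+1 - s) * c n).
  apply/funext => n; rewrite mulrBl addrA; congr (_ - _).
  rewrite fpsME seriesEord mulr_suml -big_split /=.
  by apply: eq_bigr => k _; rewrite -mulrDr subrK.
rewrite -[X in _ --> X]addr0; apply: cvgD.
  apply: (triangular_sum_cvg0 (h := fun n k => c (n - k)%N - c n) (C := C + C)
    u0 us) => [n k|k].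
    by rewrite (le_trans (ler_normB _ _)) // lerD.
  exact: slowly_varying_shift.
apply: norm_cvg0.
have us0 : `|series u n.+1 - s| * C @[n --> \oo] --> 0 * C.
  apply: cvgM; last exact: cvg_cst.
  rewrite -(normr0 R); apply: cvg_norm; rewrite -(subrr s).
  by apply: cvgB; [rewrite cvg_shiftS | exact: cvg_cst].
rewrite mul0r in us0; apply: squeeze_cvgr (cvg_cst _) us0.
by near=> n; rewrite normr_ge0 normrM ler_wpM2l.
Unshelve. all: by end_near. Qed.

End NonnegativeConvolution.

(** * Renewal equation *)

Section Renewal.
Context {R : realType}.
Implicit Types (u v f c e : fps R).

Lemma cvg0D (u v : nat -> R) : u n @[n --> \oo] --> (0 : R) ->
  v n @[n --> \oo] --> (0 : R) -> u n + v n @[n --> \oo] --> (0 : R).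
Proof. by move=> u0 v0; rewrite -[X in _ --> X]addr0; exact: cvgD. Qed.

Lemma cvg0B (u v : nat -> R) : u n @[n --> \oo] --> (0 : R) ->
  v n @[n --> \oo] --> (0 : R) -> u n - v n @[n --> \oo] --> (0 : R).
Proof. by move=> u0 v0; rewrite -[X in _ --> X]subr0; exact: cvgB. Qed.

Lemma fps_monomM_cvg0 k u : u n @[n --> \oo] --> (0 : R) ->
  (fps_monom k * u : fps R) n @[n --> \oo] --> (0 : R).
Proof.
move=> u0; apply: cvg_trans (cvg_shift k u0); apply: near_eq_cvg.
near=> n; rewrite fps_monomM ifT //; near: n; exact: nbhs_infty_ge.
Unshelve. all: by end_near. Qed.

(** Isolate the term [k] of [f * e]. In the others [e] is at most [L + g], where [g] is the positive
    part of [e - L]: the convolution [f * g] tends to 0, and the remaining mass of [f] is at most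
    [1 - f k]. As [L >= 0], a mass deficit on a finite range does no harm. *)
Lemma renewal_step f e (L B : R) k : (forall j, 0 <= f j) ->
  series f n @[n --> \oo] --> (1 : R) -> (forall n, `|e n| <= B) -> 0 <= L ->
  (e - f * e : fps R) n @[n --> \oo] --> (0 : R) ->
  (forall b, L < b -> \forall n \near \oo, e n <= b) ->
  exists2 o : nat -> R, o n @[n --> \oo] --> (0 : R) &
    forall n, (k <= n)%N -> e n - L <= o n + f k * (e (n - k)%N - L).
Proof.
move=> f0 f1 eB L0 eo eL; pose g : fps R := fun n => Num.max (e n - L) 0.
have g0 : g n @[n --> \oo] --> (0 : R).
  apply/cvgr0Pnorm_le => b b0; have {}eL := eL (L + b) ltac:(lra).
  near=> n; have en : e n <= L + b by near: n.
  rewrite ger0_norm ?/g ?le_max ?lexx ?orbT // ge_max (ltW b0) andbT.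
  by rewrite lerBlDr addrC.
exists (fun n => (e - f * e) n + (f * g) n).
  apply: cvg0D => //; rewrite -[X in _ --> X](mulr0 1); exact: fps_mul_cvg.
move=> n kn; rewrite !fpsBE !fpsME.
pose K := Ordinal (kn : (k < n.+1)%N).
have split_k v : \sum_(j < n.+1) f j * v (n - j)%N =
    f k * v (n - k)%N + \sum_(j < n.+1 | j != K) f j * v (n - j)%N.
  by rewrite (bigD1 K).
rewrite (split_k e) (split_k g).
have fS : \sum_(j < n.+1) f j <= 1.
  by have := nneg_series_le n.+1 f0 f1; rewrite seriesEord.
rewrite (bigD1 K) //= in fS.
have gk : 0 <= f k * g (n - k)%N by rewrite mulr_ge0 // /g le_max lexx orbT.
have : \sum_(i < n.+1 | i != K) f i * e (n - i)%N
   <= \sum_(i < n.+1 | i != K) f i * g (n - i)%N + (\sum_(i < n.+1 | i != K) f i) * L.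
  rewrite mulr_suml -big_split /=; apply: ler_sum => i _.
  by rewrite -mulrDr ler_wpM2l // -lerBlDr /g le_max lexx.
set S1 := \sum_(i < _ | _) _ * e _; set S2 := \sum_(i < _ | _) _ * g _.
set S3 := \sum_(i < _ | _) _ in fS *; nra.
Unshelve. all: by end_near. Qed.

(** By [renewal_step], closeness of [e n] to the asymptotic upper bound [L] forces [e (n - k)] to be
    close to [L] too, at the cost of a factor [1 / f k]; this is iterated [M] times. *)
Lemma renewal_iter e f (L B : R) k M : 0 < f k ->
  (forall j, 0 <= f j) ->
  series f n @[n --> \oo] --> (1 : R) -> (forall n, `|e n| <= B) -> 0 <= L ->
  (e - f * e : fps R) n @[n --> \oo] --> (0 : R) ->
  (forall b, L < b -> \forall n \near \oo, e n <= b) ->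
  forall b, 0 < b -> exists2 t, 0 < t & \forall n \near \oo, L - e n < t ->
    forall i, (i <= M)%N -> L - e (n - i * k)%N < b.
Proof.
move=> fk f0 f1 eB L0 eo eL.
have [r r0 step] := renewal_step k f0 f1 eB L0 eo eL.
elim: M => [|M IH] b b0.
  exists b => //; near=> n => nb i; rewrite leqn0 => /eqP ->.
  by rewrite mul0n subn0.
(* A gap below [f k * b / 2] at [n - M * k] and an error of at most [f k * b / 4] give a gap below
   [b] one step further back; the minimum with [b] preserves the earlier steps. *)
have b'0 : 0 < Num.min b (f k * b / 2).
  by rewrite lt_min b0 divr_gt0 // mulr_gt0.
have [t t0 IHn] := IH _ b'0; exists t => //.
have {}r0 : \forall n \near \oo, `|r n| <= f k * b / 4.
  by move/cvgr0Pnorm_le : r0; apply; rewrite divr_gt0 // mulr_gt0.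
have [N _ rN] := r0.
near=> n => nt.
have IHn' : L - e n < t -> forall i, (i <= M)%N ->
    L - e (n - i * k)%N < Num.min b (f k * b / 2) by near: n.
have {}IHn' := IHn' nt.
have nN : (N + M.+1 * k <= n)%N by near: n; exact: nbhs_infty_ge.
move=> i; rewrite leq_eqVlt => /predU1P[->|]; last first.
  by rewrite ltnS => /IHn'; rewrite lt_min => /andP[].
have := IHn' M (leqnn M); rewrite lt_min => /andP[_ hM].
have := step (n - M * k)%N ltac:(lia).
have := rN (n - M * k)%N ltac:(rewrite /=; lia).
rewrite (_ : n - M * k - k = n - M.+1 * k)%N; last lia.
rewrite /= ler_norml => /andP[_ rM] st.
have : f k * (L - e (n - M.+1 * k)%N) < f k * b by nra.
by rewrite ltr_pM2l.
Unshelve. all: by end_near. Qed.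

(* Let [L] be the limsup of the increments [e] of [c] along [k].  As [e] almost
   satisfies the homogeneous renewal equation and [f k > 0], when [e n] is close
   to [L] so are [e (n - k)], ..., [e (n - M k)]; if [L > 0] these telescope to
   an increment of [c] of order [M L], against the boundedness of [c]. *)
Lemma renewal_shift_ub f c (B : R) k : (forall j, 0 <= f j) ->
  series f n @[n --> \oo] --> (1 : R) -> (forall n, `|c n| <= B) ->
  (c - f * c : fps R) n @[n --> \oo] --> (0 : R) -> 0 < f k ->
  forall b, 0 < b -> \forall n \near \oo, (c - fps_monom k * c : fps R) n <= b.
Proof.
move=> f0 f1 cB co fk; set e : fps R := c - fps_monom k * c.
have eE n : (k <= n)%N -> e n = c n - c (n - k)%N.
  by move=> kn; rewrite /e fpsBE fps_monomM kn.
have B0 : 0 <= B by apply: le_trans (cB 0%N).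
have eB n : `|e n| <= B + B.
  rewrite /e fpsBE (le_trans (ler_normB _ _)) // lerD // fps_monomM.
  by case: ifP; rewrite ?normr0.
have eo : (e - f * e : fps R) n @[n --> \oo] --> (0 : R).
  (* The operators [1 - f] and [1 - fps_monom k] commute, so [e] inherits the approximate renewal
     equation of [c]. *)
  have -> : e - f * e = (c - f * c) - fps_monom k * (c - f * c) by rewrite /e; ring.
  exact: cvg0B co (fps_monomM_cvg0 k co).
(* The infimum of the eventual upper bounds is the limsup of [e]. *)
pose A := [set b | \forall n \near \oo, e n <= b].
have A_lb : lbound A (- (B + B)).
  move=> b [N _ /(_ N (leqnn N))] /=; apply: le_trans.
  by move: (eB N); rewrite ler_norml => /andP[].
have A_inf : has_inf A.
  split; last by exists (- (B + B)).
  exists (B + B); near=> n; exact: le_trans (ler_norm _) (eB n).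
have A_up b : inf A < b -> \forall n \near \oo, e n <= b.
  move=> Lb; have [|a Aa ab] := @inf_adherent _ A (b - inf A) _ A_inf; first by rewrite subr_gt0.
  move: ab; rewrite addrC subrK => ab; move: Aa; rewrite /A /=.
  by apply: filterS => n /le_trans; apply; exact: ltW.
have [L0|L0] := leP (inf A) 0.
  by move=> b b0; apply: A_up; exact: le_lt_trans b0.
exfalso.
pose L := inf A.
have L2 : 0 < L / 2 by rewrite divr_gt0.
(* With this [M], a sum of [M] increments of at least [L / 2] exceeds [B + B], the largest possible
   variation of [c]. *)
pose M := (Num.bound ((B + B) / (L / 2))).
have MB : B + B < M%:R * (L / 2).
  by rewrite -ltr_pdivrMr // archi_boundP // divr_ge0 ?addr_ge0 // ltW.
have [t t0 near_t] := renewal_iter M fk f0 f1 eB (ltW L0) eo A_up L2.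
have [N _ hN] := near_t.
(* Otherwise [L - t] would be an eventual upper bound smaller than the infimum. *)
have [n nN nt] : exists2 n, (N + M * k <= n)%N & L - e n < t.
  apply: contrapT => noex.
  have : A (L - t).
    exists (N + M * k)%N => // n /= nN; rewrite leNgt; apply/negP => Le.
    by apply: noex; exists n => //; rewrite ltrBlDr -ltrBlDl.
  by move=> /(inf_lbound A_inf.2); rewrite -/L lerBrDr gerDl leNgt t0.
have {}hN := hN n ltac:(rewrite /=; lia) nt.
have : M%:R * (L / 2) <= \sum_(0 <= i < M) e (n - i * k)%N.
  have -> : M%:R * (L / 2) = \sum_(0 <= i < M) L / 2.
    by rewrite sumr_const_nat subn0 mulr_natl.
  rewrite !big_mkord; apply: ler_sum => i _.
  by have := hN i ltac:(exact: ltnW); rewrite -/L; lra.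
have -> : \sum_(0 <= i < M) e (n - i * k)%N = c n - c (n - M * k)%N.
  transitivity (\sum_(0 <= i < M) (- c (n - i.+1 * k)%N - - c (n - i * k)%N)).
    rewrite !big_mkord; apply: eq_bigr => i _.
    have iM : (i.+1 * k <= M * k)%N by rewrite leq_mul2r ltn_ord orbT.
    rewrite eE; last by lia.
    rewrite (_ : n - i * k - k = n - i.+1 * k)%N; last by lia.
    by rewrite opprK addrC.
  by rewrite telescope_sumr // mul0n subn0 opprK addrC.
have := cB n; have := cB (n - M * k)%N; rewrite !ler_norml; lra.
Unshelve. all: by end_near. Qed.

(** The hypotheses on [c] also hold for its opposite, so the upper bound yields the lower one; both
    are read at [n + k]. *)
Lemma renewal_shift f c (B : R) k : (forall j, 0 <= f j) ->
  series f n @[n --> \oo] --> (1 : R) -> (forall n, `|c n| <= B) ->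
  (c - f * c : fps R) n @[n --> \oo] --> (0 : R) -> 0 < f k ->
  c (n + k)%N - c n @[n --> \oo] --> (0 : R).
Proof.
move=> f0 f1 cB co fk.
have ub := renewal_shift_ub f0 f1 cB co fk.
have lb : forall b, 0 < b -> \forall n \near \oo, (- c - fps_monom k * (- c) : fps R) n <= b.
  apply: (renewal_shift_ub (f := f) (B := B)) => // [n|]; first by rewrite fpsNE normrN.
  rewrite (_ : _ - _ = - (c - f * c)); last by ring.
  by rewrite -[X in _ --> X](@oppr0 R); apply: cvgN.
apply/cvgr0Pnorm_le => b b0.
have [N1 _ h1] := ub _ b0; have [N2 _ h2] := lb _ b0.
near=> n.
have nN : (N1 + N2 <= n)%N by near: n; exact: nbhs_infty_ge.
have := h1 (n + k)%N ltac:(rewrite /=; lia).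
have := h2 (n + k)%N ltac:(rewrite /=; lia).
by rewrite /= !fpsBE !fps_monomM leq_addl !fpsNE addnK ler_norml; lra.
Unshelve. all: by end_near. Qed.

(** The lags [k] along which the increments vanish are closed under sums and differences. By
    Euclidean division the least positive one divides all of them, hence divides 1. *)
Lemma aperiodic_shift c (K : set nat) :
  (forall k, K k -> c (n + k)%N - c n @[n --> \oo] --> (0 : R)) ->
  (forall d, (forall k, K k -> (d %| k)%N) -> (d %| 1)%N) ->
  c n.+1 - c n @[n --> \oo] --> (0 : R).
Proof.
move=> cK gcd1.
pose Z k := `[< c (n + k)%N - c n @[n --> \oo] --> (0 : R) >].
have Z0 : Z 0%N.
  apply/asboolP; rewrite (_ : (fun _ => _) = cst 0); first exact: cvg_cst.
  by apply/funext => n; rewrite addn0 subrr.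
have shift k j : Z k -> c (n + j + k)%N - c (n + j)%N @[n --> \oo] --> (0 : R).
  by move=> /asboolP h; have := h; rewrite -(cvg_shiftn j).
have ZD k j : Z k -> Z j -> Z (j + k)%N.
  move=> Zk /asboolP Zj; apply/asboolP.
  have := cvg0D (shift k j Zk) Zj.
  apply: cvg_trans; apply: near_eq_cvg; near=> n.
  by rewrite addrA subrK addnA.
have ZB k j : Z (k + j)%N -> Z j -> Z k.
  move=> /asboolP Zkj Zj; apply/asboolP.
  have := cvg0B Zkj (shift j k Zj).
  apply: cvg_trans; apply: near_eq_cvg; near=> n.
  by rewrite /= addnA; lra.
(* Without a positive lag, [K] would contain at most 0, and 0 would divide 1. *)
have [k /andP[k0 Zk]] : exists k, (0 < k)%N && Z k.
  apply: contrapT => noZ; suff : (0 %| 1)%N by [].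
  apply: gcd1 => k Kk; rewrite dvd0n -leqn0 leqNgt; apply/negP => k0.
  by apply: noZ; exists k; rewrite k0; apply/asboolP/cK.
have exZ : exists k, (0 < k)%N && Z k by exists k; rewrite k0.
case: (ex_minnP exZ) => d /andP[d0 Zd] dmin.
have Zmul q : Z (q * d)%N by elim: q => [|q IH]; rewrite ?mul0n // mulSn ZD.
have dK j : Z j -> (d %| j)%N.
  move=> Zj; have Zmod : Z (j %% d)%N.
    by apply: (ZB _ (j %/ d * d)%N); rewrite // addnC -divn_eq.
  rewrite /dvdn eqn0Ngt; apply/negP => m0.
  by have := dmin _ (introT andP (conj m0 Zmod)); rewrite leqNgt ltn_mod d0.
have : (d %| 1)%N by apply: gcd1 => j Kj; apply: dK; apply/asboolP/cK.
rewrite dvdn1 => /eqP d1; move: Zd; rewrite d1 => /asboolP.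
by under eq_fun do rewrite addn1.
Unshelve. all: by end_near. Qed.
End Renewal.

(** * Potential kernels of sequences *)

Section PotentialKernel.
Context {R : realType}.
Implicit Types (u v f g h w p q r : fps R).

Lemma nneg_fpsM u v : (forall n, 0 <= u n) -> (forall n, 0 <= v n) ->
  forall n, 0 <= (u * v : fps R) n.
Proof. by move=> u0 v0 n; rewrite fpsME sumr_ge0 // => k _; rewrite mulr_ge0. Qed.

Lemma series_fpsB u v n : series (u - v : fps R) n = series u n - series v n.
Proof. by rewrite /series /= -sumrB. Qed.

Lemma series_fps1S n : series (1 : fps R) n.+1 = 1.
Proof. by rewrite -fps_onesM mulr1. Qed.

Lemma series_fps1_le1 n : series (1 : fps R) n <= 1.
Proof. by case: n => [|n]; rewrite ?series_fps1S // /series /= big_geq. Qed.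

(** Summation is multiplication by [fps_ones], so the partial sums of [u * v] are [u] convolved with
    the partial sums of [v]. *)
Lemma series_fpsM u v (s t : R) : (forall n, 0 <= u n) ->
  series u n @[n --> \oo] --> s -> series v n @[n --> \oo] --> t ->
  series (u * v : fps R) n @[n --> \oo] --> s * t.
Proof.
move=> u0 us vt; rewrite -cvg_shiftS.
have -> : (fun n => series (u * v : fps R) n.+1) = (u * (fps_ones * v) : fps R).
  by apply/funext => n; rewrite -fps_onesM mulrCA.
apply: fps_mul_cvg u0 us _.
have -> : (fps_ones * v : fps R) = (fun n => series v n.+1).
  by apply/funext => n; rewrite fps_onesM.
by rewrite cvg_shiftS.
Qed.

(** The partial sums [U] of [u] are nondecreasing, so the equation gives [U <= W + H * U] before any
    convergence is known. *)
Lemma renewal_series_le u w h (W H : R) :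
  (forall n, 0 <= u n) -> (forall n, 0 <= h n) -> u = w + h * u ->
  (forall n, series w n <= W) -> (forall n, series h n <= H) -> H < 1 ->
  forall n, series u n <= W / (1 - H).
Proof.
move=> u0 h0 uE wW hH H1 n; rewrite ler_pdivlMr ?subr_gt0 // mulrBr mulr1.
rewrite lerBlDr; case: n => [|n].
  have := wW 0%N; have := hH 0%N; rewrite /series /= !big_geq //.
  by rewrite mul0r addr0.
rewrite -[X in X <= _]fps_onesM [X in fps_ones * X]uE mulrDr fpsDE fps_onesM lerD //.
rewrite mulrCA fpsME.
apply: (@le_trans _ _ (\sum_(k < n.+1) h k * series u n.+1)).
  apply: ler_sum => k _; rewrite fps_onesM ler_wpM2l //.
  apply: nondecreasing_series => [i _ _|]; first exact: u0.
  by rewrite ltnS leq_subr.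
rewrite -mulr_suml mulrC ler_wpM2l //; first by rewrite /series /= sumr_ge0.
by have := hH n.+1; rewrite seriesEord.
Qed.

(** A finite sum would satisfy [s = 1 + s]. *)
Lemma renewal_not_summable u h (s : R) : (forall n, 0 <= h n) -> u = 1 + h * u ->
  series h n @[n --> \oo] --> (1 : R) -> ~ series u n @[n --> \oo] --> s.
Proof.
move=> h0 uE h1 us.
have := series_fpsM h0 h1 us.
have : series (1 : fps R) n @[n --> \oo] --> (1 : R).
  rewrite -cvg_shiftS.
  under eq_fun do rewrite series_fps1S.
  exact: cvg_cst.
move=> one; rewrite mul1r => hu.
have us' : series u n @[n --> \oo] --> 1 + s.
  have -> : (fun n => series u n) =
      (fun n => series (1 : fps R) n + series (h * u : fps R) n).
    by apply/funext => n; rewrite {1}uE /series /= -big_split.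
  exact: cvgD.
have : s = 1 + s by apply: cvg_unique us us'.
by lra.
Qed.

(** With [E] for [fps_ones], [E (p - q) = (E (1 - g)) p], and the coefficients of [E (1 - g)] are
    the tails [1 - series g], which are nonnegative. *)
Lemma potential_ge0 p q g n : (forall k, 0 <= p k) ->
  q = g * p -> (forall k, series g k <= 1) ->
  0 <= series p n - series q n.
Proof.
move=> p0 qE g1; case: n => [|n]; first by rewrite /series /= !big_geq // subr0.
rewrite -!fps_onesM -fpsBE qE.
have -> : fps_ones * p - fps_ones * (g * p) = (fps_ones * (1 - g)) * p by ring.
rewrite nneg_fpsM // => k.
by rewrite mulrBr mulr1 fpsBE fps_onesM subr_ge0.
Qed.

(** The difference between [series v] and the potential is the potential of [q] against [f * q], to
    which [potential_ge0] applies. *)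
Lemma potential_le p q f v (V : R) n : (forall k, 0 <= q k) ->
  p = v + f * q -> (forall k, series f k <= 1) -> (forall k, series v k <= V) ->
  series p n - series q n <= V.
Proof.
move=> q0 pE f1 vV; rewrite (le_trans _ (vV n)) // -subr_ge0.
suff -> : series v n - (series p n - series q n) = series q n - series (f * q : fps R) n.
  exact: potential_ge0.
by rewrite pE /series /= -!sumrB; apply: eq_bigr => k _; rewrite fpsDE; ring.
Qed.

(** The potential is bounded by [potential_le]. Since [p - r * p = 1], applying [1 - r] to it leaves
    the tails of [g], which tend to 0 because [g] has mass 1; the renewal lemmas then apply. *)
Lemma potential_slowly_varying p q r f g v (V : R) :
  (forall k, 0 <= p k) -> (forall k, 0 <= r k) -> (forall k, 0 <= g k) ->
  p = 1 + r * p -> q = g * p -> p = v + f * q ->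
  series r n @[n --> \oo] --> (1 : R) -> series g n @[n --> \oo] --> (1 : R) ->
  (forall k, series f k <= 1) -> (forall k, series v k <= V) ->
  (forall d, (forall k, 0 < r k -> (d %| k)%N) -> (d %| 1)%N) ->
  (fps_ones * (p - q) : fps R) n.+1 - (fps_ones * (p - q) : fps R) n
    @[n --> \oo] --> (0 : R).
Proof.
move=> p0 r0 g0 pE qE pqE r1 g1 f1 vV gcd1.
have q0 k : 0 <= q k by rewrite qE nneg_fpsM.
have gle k : series g k <= 1 by exact: nneg_series_le.
have aB n : `|(fps_ones * (p - q) : fps R) n| <= V.
  rewrite fps_onesM series_fpsB ger0_norm; last exact: potential_ge0 qE gle.
  exact: potential_le pqE f1 vV.
apply: (aperiodic_shift (K := [set k | 0 < r k])) => // k rk.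
apply: renewal_shift r0 r1 aB _ rk.
have -> : fps_ones * (p - q) - r * (fps_ones * (p - q)) = fps_ones * (1 - g).
  have {}pE : p - r * p = 1 by rewrite {1}pE addrK.
  transitivity (fps_ones * (1 - g) * (p - r * p)); first by rewrite qE; ring.
  by rewrite pE mulr1.
have -> : (fps_ones * (1 - g) : fps R) = (fun n => 1 - series g n.+1).
  by apply/funext => n; rewrite mulrBr mulr1 fpsBE fps_onesM.
by rewrite -[X in _ --> X](subrr (1 : R)); apply: cvgB; [exact: cvg_cst|rewrite cvg_shiftS].
Qed.

(** * The limit at two points, in terms of sequences *)

Section TwoPoints.
Variables (pxx pyx pxy pyy f g vx vy : fps R) (Vx Vy phi gam : R).
Hypotheses (pxx0 : forall n, 0 <= pxx n) (pyy0 : forall n, 0 <= pyy n)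
  (f0 : forall n, 0 <= f n) (g0 : forall n, 0 <= g n)
  (vx0 : forall n, 0 <= vx n) (vy0 : forall n, 0 <= vy n).
Hypotheses (pyxE : pyx = g * pxx) (pxyE : pxy = f * pyy)
  (pxxE : pxx = vx + f * pyx) (pyyE : pyy = vy + g * pxy).
Hypotheses (vxV : series vx n @[n --> \oo] --> Vx) (vyV : series vy n @[n --> \oo] --> Vy)
  (fphi : series f n @[n --> \oo] --> phi) (ggam : series g n @[n --> \oo] --> gam)
  (Vy0 : 0 < Vy).

Lemma transient_potential_cvg (Gx Gy : R) :
  series pxx n @[n --> \oo] --> Gx -> series pyy n @[n --> \oo] --> Gy ->
  (series pxx n - series pyx n) + Vx / Vy * (series pyy n - series pxy n)
    @[n --> \oo] --> Vx + Gx * (1 - phi) * (1 - gam).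
Proof.
move=> xG yG.
have yxG : series pyx n @[n --> \oo] --> gam * Gx by rewrite pyxE; exact: (series_fpsM g0 ggam xG).
have xyG : series pxy n @[n --> \oo] --> phi * Gy by rewrite pxyE; exact: (series_fpsM f0 fphi yG).
have GxE : Gx = Vx + phi * (gam * Gx).
  have xG' : series pxx n @[n --> \oo] --> Vx + phi * (gam * Gx).
    have -> : (fun n => series pxx n) =
        (fun n => series vx n + series (f * pyx : fps R) n).
      by apply/funext => n; rewrite pxxE /series /= -big_split.
    exact: cvgD vxV (series_fpsM f0 fphi yxG).
  exact: (cvg_unique _ xG xG').
have GyE : Gy = Vy + gam * (phi * Gy).
  have yG' : series pyy n @[n --> \oo] --> Vy + gam * (phi * Gy).
    have -> : (fun n => series pyy n) =
        (fun n => series vy n + series (g * pxy : fps R) n).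
      by apply/funext => n; rewrite pyyE /series /= -big_split.
    exact: cvgD vyV (series_fpsM g0 ggam xyG).
  exact: (cvg_unique _ yG yG').
(* Both [Vx / Gx] and [Vy / Gy] amount to [1 - phi * gam]. This turns [Vx / Vy * (Gy - phi * Gy)]
   into [Gx * (1 - phi)], so the limit is [Gx * (2 - phi - gam)]. *)
have VG : Vx * Gy = Vy * Gx.
  have -> : Vx = Gx - phi * (gam * Gx) by lra.
  have -> : Vy = Gy - gam * (phi * Gy) by lra.
  by ring.
have -> : Vx + Gx * (1 - phi) * (1 - gam) = (Gx - gam * Gx) + Vx / Vy * (Gy - phi * Gy).
  have -> : Vx / Vy * (Gy - phi * Gy) = Gx * (1 - phi).
    transitivity (Vx * Gy / Vy * (1 - phi)); first by ring.
    by rewrite VG [Vy * Gx]mulrC mulfK ?gt_eqF.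
  have -> : Vx = Gx - phi * (gam * Gx) by lra.
  by ring.
by apply: cvgD; [exact: cvgB | apply: cvgM; [exact: cvg_cst | exact: cvgB]].
Qed.

Lemma recurrent_potential_cvg (fxx fyy : fps R) :
  phi = 1 -> gam = 1 ->
  (forall n, 0 <= fxx n) -> (forall n, 0 <= fyy n) ->
  pxx = 1 + fxx * pxx -> pyy = 1 + fyy * pyy ->
  series fxx n @[n --> \oo] --> (1 : R) -> series fyy n @[n --> \oo] --> (1 : R) ->
  (forall d, (forall k, 0 < fxx k -> (d %| k)%N) -> (d %| 1)%N) ->
  (forall d, (forall k, 0 < fyy k -> (d %| k)%N) -> (d %| 1)%N) ->
  (series pxx n - series pyx n) + Vx / Vy * (series pyy n - series pxy n)
    @[n --> \oo] --> Vx.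
Proof.
move=> phi1 gam1 fxx0 fyy0 pxxR pyyR fxx1 fyy1 gcdx gcdy; 
have f1 : series f n @[n --> \oo] --> (1 : R) by rewrite -phi1.
have g1 : series g n @[n --> \oo] --> (1 : R) by rewrite -gam1.
pose a := fps_ones * (pxx - pyx); pose b := fps_ones * (pyy - pxy).
have fle k : series f k <= 1 by exact: nneg_series_le.
have gle k : series g k <= 1 by exact: nneg_series_le.
have vxle k : series vx k <= Vx by exact: nneg_series_le.
have vyle k : series vy k <= Vy by exact: nneg_series_le.
have a_slow : a n.+1 - a n @[n --> \oo] --> (0 : R).
  exact: potential_slowly_varying pxxR pyxE pxxE fxx1 g1 fle vxle gcdx.
have b_slow : b n.+1 - b n @[n --> \oo] --> (0 : R).
  exact: potential_slowly_varying pyyR pxyE pyyE fyy1 f1 gle vyle gcdy.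
have pyx0 k : 0 <= pyx k by rewrite pyxE nneg_fpsM.
have pxy0 k : 0 <= pxy k by rewrite pxyE nneg_fpsM.
have aB n : `|a n| <= Vx.
  rewrite /a fps_onesM series_fpsB ger0_norm; last exact: potential_ge0 pyxE gle.
  exact: potential_le pxxE fle vxle.
have bB n : `|b n| <= Vy.
  rewrite /b fps_onesM series_fpsB ger0_norm; last exact: potential_ge0 pxyE fle.
  exact: potential_le pyyE gle vyle.
(* Here [vx = (1 - f g) pxx] and [vy = (1 - f g) pyy], while [a = E (1 - g) pxx] and
   [b = E (1 - f) pyy]; the identity reduces to [(1 - g) + g (1 - f) = 1 - f g]. *)
have ab : vy * a + (vx * g) * b = fps_ones * (vx * vy).
  have vxE : vx = pxx - f * g * pxx by rewrite {1}pxxE pyxE; ring.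
  have vyE : vy = pyy - f * g * pyy by rewrite {1}pyyE pxyE; ring.
  by rewrite /a /b vxE vyE pyxE pxyE; ring.
have va := fps_mul_slowly_varying vy0 vyV aB a_slow.
have vb := fps_mul_slowly_varying (nneg_fpsM vx0 g0) (series_fpsM vx0 vxV g1) bB b_slow.
have vv := series_fpsM vx0 vxV vyV.
rewrite -cvg_shiftS.
(* The error made in replacing the convolutions by multiples of [a n] and [b n]; the factor 1 is the
   mass of [g]. *)
pose err n := ((vy * a) n - Vy * a n) + ((vx * g * b) n - Vx * 1 * b n).
have -> : (fun n => (series pxx n.+1 - series pyx n.+1) +
    Vx / Vy * (series pyy n.+1 - series pxy n.+1)) =
  (fun n => (series (vx * vy : fps R) n.+1 - err n) / Vy).
  apply/funext => n.
  rewrite -!series_fpsB -!fps_onesM -/a -/b /err -ab fpsDE; field.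
  by rewrite gt_eqF.
have lim : (series (vx * vy : fps R) n.+1 - err n) / Vy @[n --> \oo]
    --> (Vx * Vy - 0) / Vy.
  apply: cvgM; last exact: cvg_cst.
  by apply: cvgB; [rewrite cvg_shiftS | exact: cvg0D].
by move: lim; rewrite subr0 mulfK ?gt_eqF.
Qed.

End TwoPoints.
End PotentialKernel.

Local Open Scope ereal_scope.

(** * Paths of the chain *)

Section CountableSums.
Context {R : realType} {I : countType}.
Implicit Types (D : set I) (a : I -> \bar R).

(** Enumerating the states by [pickle] turns an unordered sum into a series, so scaling of series
    and additivity over sequences of sets carry over to sums over states. *)
Lemma esum_unpickle D a : (forall z, D z -> 0 <= a z) ->
  \esum_(z in D) a z =
  \sum_(j <oo | j \in pickle @` D) oapp a 0 (unpickle j).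
Proof.
move=> a0; rewrite nneseries_esum => [|j]; last first.
  by rewrite inE => -[z Dz <-]; rewrite pickleK /=; exact: a0.
rewrite set_mem_set esum_image; last by move=> z t _ _; exact: (pcan_inj pickleK).
by apply: eq_esum => z _; rewrite pickleK.
Qed.

Lemma esumZl (c : R) D a : (forall z, D z -> 0 <= a z) -> (0 <= c)%R ->
  \esum_(z in D) (c%:E * a z) = c%:E * \esum_(z in D) a z.
Proof.
move=> a0 c0; rewrite !esum_unpickle => [||z Dz]; [|exact: a0|]; last first.
  by rewrite mule_ge0 ?lee_fin ?a0.
rewrite -nneseriesZl => [|j]; last first.
  by rewrite inE => -[z Dz <-]; rewrite pickleK; exact: a0.
by apply: eq_eseriesr => j _; case: (unpickle j) => //=; rewrite mule0.
Qed.

Lemma measure_bigcup_countable d (T : sigmaRingType d)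
    (mu : {measure set T -> \bar R}) D (F : I -> set T) :
  (forall z, D z -> measurable (F z)) -> trivIset D F ->
  mu (\bigcup_(z in D) F z) = \esum_(z in D) mu (F z).
Proof.
move=> mF tF; rewrite esum_unpickle; last by move=> z _; exact: measure_ge0.
have -> : \bigcup_(z in D) F z = \bigcup_(j in pickle @` D) oapp F set0 (unpickle j).
  rewrite bigcup_image; apply: eq_bigcupr => z _; by rewrite pickleK.
rewrite measure_bigcup.
- by apply: eq_eseriesr => j; rewrite inE => -[z Dz <-]; rewrite pickleK.
- by move=> _ [z Dz <-]; rewrite pickleK; exact: mF.
- move=> _ _ [z Dz <-] [t Dt <-]; rewrite !pickleK /= => zt.
  by congr pickle; exact: tF.
Qed.

End CountableSums.

Section Paths.
Context {R : realType} {I : countType} {d : measure_display} {Om : measurableType d}.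
Context {P : I -> probability Om R} {S : nat -> Om -> I} {p : I -> I -> R}.
Hypothesis hS : is_markov_chain P S p.

Lemma measurable_state (A : set I) n : measurable [set w | A (S n w)].
Proof.
rewrite (_ : [set w | _] = \bigcup_z [set w | A z /\ S n w = z]); last first.
  apply/seteqP; split => [w Aw|w [z _ [Az wz]]]; last by rewrite /= wz.
  by exists (S n w).
apply: countable_bigcupT_measurable => // z.
have [Az|nAz] := pselect (A z); last first.
  by rewrite (_ : mkset _ = set0) //; apply/seteqP; split => w // [].
rewrite (_ : mkset _ = [set w | S n w = z]); first exact: chain_measurable hS n z.
by apply/seteqP; split => w // [].
Qed.

(** The events in which [chain_step] states the Markov property. *)
Definition cylinder (i : nat -> I) m : set Om :=
  [set w | forall k, (k <= m)%N -> S k w = i k].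

Lemma measurable_states (A : nat -> set I) m n :
  measurable [set w | forall j, (j < n)%N -> A j (S (m + j).+1 w)].
Proof.
rewrite (_ : mkset _ = \bigcap_(j in [set j | (j < n)%N]) [set w | A j (S (m + j).+1 w)]) //.
by apply: bigcap_measurableType => j _; exact: measurable_state.
Qed.

Lemma measurable_cylinder i m : measurable (cylinder i m).
Proof.
rewrite (_ : cylinder _ _ = \bigcap_(k in [set k | (k <= m)%N]) [set w | [set i k] (S k w)]) //.
by apply: bigcap_measurableType => j _; exact: measurable_state.
Qed.

(* [path_prob A n x y] is the probability, started at x, of being in
   A 0, ..., A (n-1) at times 1, ..., n and at y at time n. *)
Fixpoint path_prob (A : nat -> set I) n x y : \bar R :=
  if n is n'.+1 then
    \esum_(z in A 0%N) ((p x z)%:E * path_prob (fun j => A j.+1) n' z y)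
  else (x == y)%:R%:E.

Lemma path_prob_ge0 A n x y : 0 <= path_prob A n x y.
Proof.
elim: n A x => [|n IH] A x /=; first by rewrite lee_fin ler0n.
by apply: esum_ge0 => z _; rewrite mule_ge0 // lee_fin (trans_ge0 hS).
Qed.

(** The constraint of [path_prob] imposed after time [m]; the offset is what moves in the induction
    on [n] below. *)
Definition path_event (A : nat -> set I) m n y : set Om :=
  [set w | (forall j, (j < n)%N -> A j (S (m + j).+1 w)) /\ S (m + n) w = y].

Lemma measurable_path_event A m n y : measurable (path_event A m n y).
Proof.
apply: measurableI; first exact: measurable_states.
exact: (measurable_state [set y] (m + n)).
Qed.

(** The Markov property at time [m] for events of the future: split by the state [z] at time [m.+1],
    absorb [z] into the cylinder, and apply [chain_step] and the induction hypothesis at [m.+1]. *)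
Lemma cylinder_path_event A m n i x y :
  P x (cylinder i m `&` path_event A m n y) =
  P x (cylinder i m) * path_prob A n (i m) y.
Proof.
elim: n A m i => [|n IH] A m i /=.
  have [iy|/eqP iy] := eqVneq (i m) y.
    rewrite mule1; congr (P x _); apply/seteqP; split => w; first by case.
    move=> cw; split => //; split => //; rewrite addn0 -iy; exact: cw.
  rewrite mule0 (_ : _ `&` _ = set0) ?measure0 //; apply/seteqP; split => // w [cw [_]].
  by rewrite addn0 cw.
pose ext z k := if k == m.+1 then z else i k.
have ext_cyl z : cylinder (ext z) m = cylinder i m.
  by apply/seteqP; split => w cw k km; have := cw k km; rewrite /ext ltn_eqF.
have extm z : ext z m = i m by rewrite /ext ltn_eqF.
have extSm z : ext z m.+1 = z by rewrite /ext eqxx.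
have -> : cylinder i m `&` path_event A m n.+1 y = \bigcup_(z in A 0%N)
    (cylinder (ext z) m.+1 `&` path_event (fun j => A j.+1) m.+1 n y).
  apply/seteqP; split => [w [cw [Aw wy]]|w [z Az [cw [Aw wy]]]].
    exists (S m.+1 w); first by have := Aw 0%N isT; rewrite addn0.
    split; last by split => [j jn|]; [rewrite addSnnS; exact: Aw|rewrite addSnnS].
    move=> k; rewrite leq_eqVlt => /predU1P[->|km]; first by rewrite extSm.
    by rewrite /ext ltn_eqF //; exact: cw.
  split; first by rewrite -(ext_cyl z) => k km; apply: cw; rewrite ltnW.
  split => [[|j] jn|]; last by rewrite -addSnnS.
    by rewrite addn0 (cw m.+1) // extSm.
  by rewrite -addSnnS; exact: Aw.
rewrite measure_bigcup_countable; first last.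
- move=> z t _ _ [w [[cz _] [ct _]]].
  by rewrite -(extSm z) -(extSm t) -(cz m.+1) // -(ct m.+1).
- move=> z _; apply: measurableI; first exact: measurable_cylinder.
  exact: measurable_path_event.
have cfin : P x (cylinder i m) \is a fin_num by apply: fin_num_measure; exact: measurable_cylinder.
rewrite -(fineK cfin) -esumZl; first last.
- exact: fine_ge0.
- by move=> z _; rewrite mule_ge0 ?path_prob_ge0 // lee_fin (trans_ge0 hS).
apply: eq_esum => z _; rewrite [LHS](IH (fun j => A j.+1) m.+1 (ext z)) extSm muleA fineK //; congr (_ * _).
by rewrite [LHS](chain_step hS) extm extSm -(ext_cyl z).
Qed.

(** The case [m = 0] of the Markov property: the cylinder [S 0 = x] has probability 1, so
    intersecting with it changes nothing. *)
Lemma path_probE A n x y :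
  P x [set w | (forall j, (j < n)%N -> A j (S j.+1 w)) /\ S n w = y] =
  path_prob A n x y.
Proof.
have start : P x (cylinder (fun=> x) 0) = 1.
  rewrite -(chain_start hS x); congr (P x _); apply/seteqP; split => w /=; first exact.
  by move=> wx k; rewrite leqn0 => /eqP ->.
have := cylinder_path_event A 0 n (fun=> x) x y; rewrite start mul1e => <-.
have mE := measurable_path_event A 0 n y.
have mC := measurable_cylinder (fun=> x) 0.
set E := path_event A 0 n y; set C := cylinder _ _.
transitivity (P x (E `\` C) + P x (E `&` C)); first exact: measureDI.
rewrite (_ : P x (E `\` C) = 0) ?add0e 1?setIC //.
apply/eqP; rewrite eq_le measure_ge0 andbT.
have <- : P x (~` C) = 0.
  by rewrite probability_setC // /C start subee.
by apply: le_measure; rewrite ?inE; [exact: measurableD|exact: measurableC|move=> w []].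
Qed.

Lemma path_prob_fin A n x y : path_prob A n x y \is a fin_num.
Proof.
by rewrite -path_probE; apply: fin_num_measure; exact: (measurable_path_event A 0 n y).
Qed.

End Paths.

Arguments path_prob {R I} p A n x y.

(** * Taboo probabilities and first passages *)

Section Kernels.
Context {R : realType} {I : countType} {d : measure_display} {Om : measurableType d}.
Context {P : I -> probability Om R} {S : nat -> Om -> I} {p : I -> I -> R}.
Hypothesis hS : is_markov_chain P S p.

(* P_x(S_1, ..., S_n are not in D, and S_n = y). *)
Definition taboo (D : set I) n x y : R :=
  fine (path_prob p (fun=> ~` D) n x y).

(* P_x(T_y = n). *)
Definition passage (y : I) n x : R :=
  if n is n'.+1 then
    fine (path_prob p (fun j => if (j < n')%N then ~` [set y] else setT) n x y)
  else 0%R.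

Lemma EFin_taboo D n x y : (taboo D n x y)%:E = path_prob p (fun=> ~` D) n x y.
Proof. by rewrite fineK // (path_prob_fin hS). Qed.

Lemma EFin_passage y n x : (passage y n.+1 x)%:E =
  path_prob p (fun j => if (j < n)%N then ~` [set y] else setT) n.+1 x y.
Proof. by rewrite fineK // (path_prob_fin hS). Qed.

Lemma taboo_ge0 D n x y : (0 <= taboo D n x y)%R.
Proof. exact/fine_ge0/(path_prob_ge0 hS). Qed.

Lemma passage_ge0 y n x : (0 <= passage y n x)%R.
Proof. by case: n => // n; exact/fine_ge0/(path_prob_ge0 hS). Qed.

Lemma taboo0 D x y : taboo D 0 x y = (x == y)%:R%R. Proof. by []. Qed.

Lemma tabooS D n x y : (taboo D n.+1 x y)%:E =
  \esum_(z in ~` D) ((p x z)%:E * (taboo D n z y)%:E).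
Proof. by rewrite EFin_taboo /=; apply: eq_esum => z _; rewrite EFin_taboo. Qed.

Lemma trans_pos x z : 0 <= (p x z)%:E. Proof. by rewrite lee_fin (trans_ge0 hS). Qed.

Lemma esum_at (a : I -> \bar R) y : (forall z, 0 <= a z) ->
  \esum_(z in setT) a z = a y + \esum_(z in ~` [set y]) a z.
Proof.
by move=> a0; rewrite (esumID [set y]) // !setTI esum_set1.
Qed.

(** First-step analysis. The direct jump to [y] counts only for [n = 0], and then the sum vanishes
    because [passage y 0 z] is 0. *)
Lemma passageS y n x : (passage y n.+1 x)%:E = (if n == 0%N then p x y else 0%R)%:E +
  \esum_(z in ~` [set y]) ((p x z)%:E * (passage y n z)%:E).
Proof.
rewrite EFin_passage /=; case: n => [|n] /=.
  rewrite (esum_at y) => [|z]; last by rewrite mule_ge0 ?trans_pos // lee_fin.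
  rewrite eqxx mule1; congr (_ + _); apply: eq_esum => z zy.
  by rewrite (_ : z == y = false) //; apply/eqP.
rewrite add0e; apply: eq_esum => z _; congr (_ * _).
by rewrite EFin_passage.
Qed.

(** Paths from [x] to [w] are sorted by the first time [k >= 1] at which they meet [y], if there is
    one up to [n]. The proof is an induction on [n] through the first-step equations. *)
Lemma first_passage_decomposition y n x w :
  taboo set0 n x w = (taboo [set y] n x w +
    \sum_(k < n.+1) passage y k x * taboo set0 (n - k) y w)%R.
Proof.
elim: n x => [|n IH] x; first by rewrite big_ord1 /= mul0r addr0 !taboo0.
(* The real [e k] is the part of [passage y k.+1 x] whose first step avoids [y]. *)
have [e [pe eE]] : exists e : nat -> R,
    (forall k, passage y k.+1 x = e k + if k == 0%N then p x y else 0)%R /\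
    (forall k, \esum_(z in ~` [set y]) ((p x z)%:E * (passage y k z)%:E) = (e k)%:E).
  exists (fun k => passage y k.+1 x - if k == 0%N then p x y else 0)%R.
  by split=> k; [rewrite subrK|rewrite EFinB passageS addeAC subee // add0e].
have step : \esum_(z in ~` [set y]) ((p x z)%:E * (taboo set0 n z w)%:E) =
    (taboo [set y] n.+1 x w + \sum_(k < n.+1) taboo set0 (n - k) y w * e k)%:E.
  transitivity (\esum_(z in ~` [set y]) ((p x z)%:E * (taboo [set y] n z w)%:E +
      \sum_(k < n.+1) (taboo set0 (n - k) y w)%:E * ((p x z)%:E * (passage y k z)%:E))).
    apply: eq_esum => z _; rewrite -EFinM IH mulrDr EFinD; congr (_ + _).
    rewrite mulr_sumr -sumEFin; apply: eq_bigr => k _.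
    by rewrite -!EFinM; congr (_%:E); ring.
  rewrite esumD; first last.
  - by move=> z _; apply: sume_ge0 => k _; rewrite -!EFinM lee_fin !mulr_ge0 ?taboo_ge0 ?passage_ge0 ?(trans_ge0 hS).
  - by move=> z _; rewrite -EFinM lee_fin mulr_ge0 ?taboo_ge0 ?(trans_ge0 hS).
  rewrite EFinD tabooS; congr (_ + _); rewrite esum_sum => [|z k _ _]; last first.
    by rewrite -!EFinM lee_fin !mulr_ge0 ?taboo_ge0 ?passage_ge0 ?(trans_ge0 hS).
  rewrite -sumEFin; apply: eq_bigr => k _.
  rewrite esumZl ?taboo_ge0 ?eE // => z _.
  by rewrite -EFinM lee_fin mulr_ge0 ?passage_ge0 ?(trans_ge0 hS).
(* The first step to [y] itself supplies the [p x y] part of [passage y 1 x]. *)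
apply: EFin_inj; rewrite tabooS setC0 (esum_at y) => [|z]; last first.
  by rewrite -EFinM lee_fin mulr_ge0 ?taboo_ge0 ?(trans_ge0 hS).
rewrite step -EFinM -EFinD; congr (_%:E).
rewrite addrCA; congr (_ + _)%R.
rewrite [RHS]big_ord_recl mul0r add0r [LHS](_ : _ = \sum_(k < n.+1)
    (taboo set0 (n - k) y w * (e k + if k == 0%N :> nat then p x y else 0)))%R.
  by apply: eq_bigr => k _; rewrite lift0 subSS pe mulrC.
under [RHS]eq_bigr do rewrite mulrDr.
rewrite big_split /= [RHS]addrC; congr (_ + _)%R; rewrite big_ord_recl /= subn0.
by rewrite big1 => [|k _]; rewrite ?mulr0 // addr0 mulrC.
Qed.

(** Common induction for the next two inequalities: [h] is a supersolution for the chain killed in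
    [D], and iterating over [n] steps retains at least the contribution of the end state [z]. *)
Lemma taboo_supersolution (D : set I) (h : nat -> I -> R) m n x z :
  (forall k u, 0 <= h k u)%R ->
  (forall k u, \esum_(v in ~` D) ((p u v)%:E * (h k v)%:E) <= (h k.+1 u)%:E) ->
  (taboo D n x z * h m z <= h (n + m)%N x)%R.
Proof.
move=> h0 hD; elim: n x => [|n IH] x.
  by rewrite taboo0; case: eqVneq => [->|_]; rewrite ?mul1r // mul0r.
rewrite -lee_fin addSn (le_trans _ (hD _ _)) // EFinM tabooS muleC -esumZl //; last first.
  by move=> v _; rewrite -EFinM lee_fin mulr_ge0 ?taboo_ge0 ?(trans_ge0 hS).
apply: le_esum => v _; rewrite -!EFinM lee_fin mulrCA ler_wpM2l ?(trans_ge0 hS) //.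
by rewrite mulrC.
Qed.

Lemma taboo_passage_le m n x z y :
  (taboo [set y] n x z * passage y m z <= passage y (n + m)%N x)%R.
Proof.
apply: taboo_supersolution => [k u|k u]; first exact: passage_ge0.
by rewrite passageS leeDr // lee_fin; case: ifP => // _; exact: trans_ge0 hS _ _.
Qed.

Lemma trans_mul_le m n x z y :
  (taboo set0 n x z * taboo set0 m z y <= taboo set0 (n + m)%N x y)%R.
Proof.
apply: (taboo_supersolution (h := fun k u => taboo set0 k u y)) => [k u|k u].
  exact: taboo_ge0.
by rewrite tabooS.
Qed.

Lemma prob_trans n x y : P x [set w | S n w = y] = (taboo set0 n x y)%:E.
Proof.
rewrite EFin_taboo -(path_probE hS); congr (P x _).
by apply/seteqP; split => w /=; [split => // j _ []|case].
Qed.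

Definition avoids y n : set Om := [set w | forall j, (j < n)%N -> S j.+1 w <> y].

Lemma prob_taboo n x y z :
  P x (avoids y n `&` [set w | S n w = z]) = (taboo [set y] n x z)%:E.
Proof. by rewrite EFin_taboo -(path_probE hS). Qed.

Lemma prob_passage n x y :
  P x (avoids y n `&` [set w | S n.+1 w = y]) = (passage y n.+1 x)%:E.
Proof.
rewrite EFin_passage -(path_probE hS); congr (P x _).
apply/seteqP; split => w /= [aw wy]; split => //.
  by move=> j _; case: ifP => // jn; exact: aw.
by move=> j jn; have := aw j (ltnW jn); rewrite jn.
Qed.

Lemma measurable_avoids y n : measurable (avoids y n).
Proof. exact: (measurable_states hS (fun=> ~` [set y]) 0 n). Qed.

Lemma hit_gtP y w n : ((n%:R%:E : \bar R) < hit S y w) <-> avoids y n w.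
Proof.
rewrite /hit; case: pselect => [h|nh].
  case: ex_minnP => m /andP[m0 /eqP Sm] mmin; rewrite lte_fin ltr_nat; split.
    move=> nm j jn Sj; have := mmin j.+1; rewrite Sj eqxx => /(_ isT); lia.
  move=> av; rewrite ltnNge; apply/negP => mn.
  by apply: (av m.-1); rewrite prednK.
by split => _; [move=> j _ Sj; apply: nh; exists j.+1; rewrite Sj eqxx|exact: ltry].
Qed.

Lemma hit_fin y w : (hit S y w < +oo :> \bar R) <-> exists n, S n.+1 w = y.
Proof.
rewrite /hit; case: pselect => [h|nh]; split => //.
- by move=> _; case: h => -[|n] // /andP[_ /eqP]; exists n.
- by move=> _; exact: ltry.
- by move=> [n wy]; case: nh; exists n.+1; rewrite wy eqxx.
Qed.

(** The sets on the right are the events [T_y = n + 1]; their disjointness is used to sum the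
    probabilities in [prob_hit_fin]. *)
Lemma hit_finE y : [set w | hit S y w < +oo :> \bar R] =
  \bigcup_n (avoids y n `&` [set w | S n.+1 w = y]).
Proof.
apply/seteqP; split => w /=; last by move=> [n _ [_ wy]]; apply/hit_fin; exists n.
move=> /hit_fin [n0 wn0].
have ex : exists n, S n.+1 w == y by exists n0; apply/eqP.
case: (ex_minnP ex) => n /eqP wy nmin; exists n => //; split => // j jn wj.
by have := nmin j; rewrite wj eqxx => /(_ isT); rewrite leqNgt jn.
Qed.

Lemma measurable_hit_fin y : measurable [set w | hit S y w < +oo :> \bar R].
Proof.
rewrite hit_finE; apply: bigcupT_measurable => n.
by apply: measurableI; [exact: measurable_avoids|exact: (measurable_state hS [set y])].
Qed.

Lemma prob_hit_fin x y :
  P x [set w | hit S y w < +oo :> \bar R] = \sum_(n <oo) (passage y n x)%:E.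
Proof.
rewrite hit_finE measure_bigcup //; first last.
- apply/trivIsetP => i j _ _; wlog ij : i j / (i < j)%N.
    move=> h; rewrite neq_ltn => /orP[] ij; last rewrite setIC; apply: h => //.
      by rewrite ltn_eqF.
    by rewrite ltn_eqF.
  move=> _; apply/seteqP; split => // w [[_ wy] [aw _]].
  exact: aw i ij wy.
- move=> n _; apply: measurableI; first exact: measurable_avoids.
  exact: (measurable_state hS [set y]).
(* The term of index 0 is 0 by definition of [passage], which permits the shift by one. *)
rewrite [RHS]nneseries_recl => [||//]; last by move=> n _; rewrite lee_fin passage_ge0.
rewrite add0e -nneseries_addn => [|n]; last by rewrite lee_fin passage_ge0.
rewrite [LHS](@eq_eseriesl _ _ xpredT) => [|n]; last by rewrite in_setT.
apply: eq_eseriesr => n _; rewrite addn1; exact: prob_passage.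
Qed.

End Kernels.

Arguments taboo {R I} p D n x y.
Arguments passage {R I} p y n x.
Arguments avoids {I d Om} S y n.

(** * Green functions and hitting probabilities as series *)

Section RealSeries.
Context {R : realType}.
Implicit Types u : fps R.

Lemma nneseries_EFin u (l : R) : series u n @[n --> \oo] --> l ->
  \sum_(n <oo) (u n)%:E = l%:E.
Proof.
move=> ul; apply/cvg_lim => //.
have -> : (fun n => \sum_(0 <= k < n) (u k)%:E) = (fun n => (series u n)%:E).
  by apply/funext => n; rewrite /series /= sumEFin.
by apply: cvg_EFin => //; exact: nearW.
Qed.

Lemma nneseries_EFin_le1 u : (forall n, 0 <= u n)%R -> \sum_(n <oo) (u n)%:E <= 1 ->
  series u n @[n --> \oo] --> fine (\sum_(n <oo) (u n)%:E).
Proof.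
move=> u0 u1; have [|s us] := @nneg_series_cvg _ u 1%R u0.
  move=> n; rewrite -lee_fin (le_trans _ u1) // /series /= -sumEFin.
  by apply: nneseries_lim_ge => k _ _; rewrite lee_fin.
by rewrite (nneseries_EFin us).
Qed.

End RealSeries.

Section Expectations.
Context {R : realType} {I : countType} {d : measure_display} {Om : measurableType d}.
Context {P : I -> probability Om R} {S : nat -> Om -> I} {p : I -> I -> R}.
Hypothesis hS : is_markov_chain P S p.

Lemma indic_bool (b : Om -> bool) w : \1_[set w | b w] w = (b w)%:R%R :> R.
Proof.
by rewrite indicE (_ : w \in _ = b w) //; apply/idP/idP => [/set_mem|/mem_set].
Qed.

Lemma integral_bool x (b : Om -> bool) : measurable [set w | b w] ->
  \int[P x]_w ((b w)%:R)%:E = P x [set w | b w].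
Proof.
move=> mb; rewrite -[RHS](congr1 (P x) (setIT _)) -integral_indic //.
by apply: eq_integral => w _; rewrite indic_bool.
Qed.

Lemma measurable_bool (b : Om -> bool) : measurable [set w | b w] ->
  measurable_fun setT (EFin \o (fun w => (b w)%:R : R)%R).
Proof.
move=> mb; apply/measurable_EFinP.
rewrite (_ : (fun w => _) = \1_[set w | b w]); first exact: measurable_indic.
by apply/funext => w; rewrite indic_bool.
Qed.

Lemma set_state_eq n y : [set w | S n w == y] = [set w | S n w = y].
Proof. by apply/seteqP; split => w /eqP. Qed.

Lemma measurable_state_eq n y : measurable [set w | S n w == y].
Proof. rewrite set_state_eq; exact: chain_measurable hS n y. Qed.

Lemma greenNE N x y :
  greenN P S N x y = (series (fun n => taboo p set0 n x y) N)%:E.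
Proof.
rewrite /greenN ge0_integral_sum //.
  rewrite /series /= -sumEFin; apply: eq_bigr => n _.
  by rewrite integral_bool ?set_state_eq ?(prob_trans hS) //; exact: chain_measurable hS n y.
by move=> n; apply: measurable_bool; exact: measurable_state_eq.
Qed.

Lemma greenE x y : green P S x y = \sum_(n <oo) (taboo p set0 n x y)%:E.
Proof.
rewrite /green integral_nneseries //.
  apply: eq_eseriesr => n _.
  by rewrite integral_bool ?set_state_eq ?(prob_trans hS) //; exact: chain_measurable hS n y.
by move=> n; apply: measurable_bool; exact: measurable_state_eq.
Qed.

(** The condition [n < T_y] says that [y] is avoided at times 1, ..., [n], so each term of the
    expectation is a taboo probability. *)
Lemma visits_beforeE x y :
  visits_before P S x y = \sum_(n <oo) (taboo p [set y] n x x)%:E.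
Proof.
pose b n w := ((n%:R%:E : \bar R) < hit S y w) && (S n w == x).
have bE n : [set w | b n w] = avoids S y n `&` [set w | S n w = x].
  apply/seteqP; split => [w /andP[/hit_gtP aw /eqP wx]|w [aw /= wx]]; first by split.
  by rewrite /= /b wx eqxx andbT; exact/hit_gtP.
have mb n : measurable [set w | b n w].
  by rewrite bE; apply: measurableI; [exact: measurable_avoids hS y n|exact: chain_measurable hS n x].
transitivity (\int[P x]_w \sum_(n <oo) ((b n w)%:R)%:E).
  apply: eq_integral => w _; rewrite eseries_mkcond; apply: eq_eseriesr => n _.
  by rewrite /b; case: ifP.
rewrite integral_nneseries //; last by move=> n; exact: measurable_bool.
by apply: eq_eseriesr => n _; rewrite integral_bool // bE (prob_taboo hS).
Qed.

Definition trans_seq x y : fps R := fun n => taboo p set0 n x y.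
Definition passage_seq x y : fps R := fun n => passage p y n x.
Definition visit_seq x y : fps R := fun n => taboo p [set y] n x x.

(** This makes the remainder of the first-passage decomposition, when the target is [y] itself,
    either 0 or the unit sequence. *)
Lemma taboo_target n x y : taboo p [set y] n x y = ((x == y) && (n == 0))%:R%R.
Proof.
case: n => [|n]; first by rewrite taboo0 andbT.
apply: EFin_inj; rewrite -(prob_taboo hS) andbF.
rewrite (_ : _ `&` _ = set0) ?measure0 //.
by apply/seteqP; split => // w [aw wy]; exact: aw n (ltnSn n) wy.
Qed.

(** This and the next two identities are instances of the first-passage decomposition; they supply
    the algebraic hypotheses of the two-point limit. *)
Lemma trans_seq_passage x y : x <> y -> trans_seq x y = (passage_seq x y * trans_seq y y)%R.
Proof.
move=> /eqP /negbTE xy; apply/funext => n.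
by rewrite [LHS](first_passage_decomposition hS y) taboo_target xy add0r.
Qed.

Lemma trans_seq_renewal x : trans_seq x x = (1 + passage_seq x x * trans_seq x x)%R.
Proof.
by apply/funext => n; rewrite [LHS](first_passage_decomposition hS x) taboo_target eqxx.
Qed.

Lemma trans_seq_detour x y : trans_seq x x = (visit_seq x y + passage_seq x y * trans_seq y x)%R.
Proof. by apply/funext => n; rewrite [LHS](first_passage_decomposition hS y). Qed.

Lemma passage_seq_cvg x y :
  series (passage_seq x y) n @[n --> \oo] --> fine (P x [set w | hit S y w < +oo :> \bar R]).
Proof.
rewrite (prob_hit_fin hS); apply: nneseries_EFin_le1 => [n|].
  exact: passage_ge0 hS _ _ _.
by rewrite -(prob_hit_fin hS) probability_le1 //; exact: measurable_hit_fin hS y.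
Qed.

Lemma prob_hit_infty x y : P x [set w | hit S y w = +oo :> \bar R] =
  (1 - fine (P x [set w | (hit S y w < +oo :> \bar R)%E]))%:E.
Proof.
have mh := measurable_hit_fin hS y.
have -> : [set w | hit S y w = +oo :> \bar R] = ~` [set w | hit S y w < +oo :> \bar R].
  apply/seteqP; split => w /=; first by move=> ->; rewrite ltxx.
  by move=> /negP; rewrite -leNgt leye_eq => /eqP.
by rewrite probability_setC // EFinB fineK // fin_num_measure.
Qed.

Lemma passage_seq_series_le1 x y n : (series (passage_seq x y) n <= 1)%R.
Proof.
have F0 k : (0 <= passage_seq x y k)%R by exact: passage_ge0 hS _ _ _.
rewrite (le_trans (nneg_series_le n F0 (@passage_seq_cvg x y))) // -lee_fin.
by rewrite fineK ?fin_num_measure ?probability_le1 //; exact: measurable_hit_fin hS y.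
Qed.

Lemma prob_hit_fin_ge0 x y : (0 <= fine (P x [set w | (hit S y w < +oo :> \bar R)%E]))%R.
Proof. exact: fine_ge0. Qed.

Lemma prob_hit_fin_le1 x y : (fine (P x [set w | (hit S y w < +oo :> \bar R)%E]) <= 1)%R.
Proof.
have mh := measurable_hit_fin hS y.
by rewrite -lee_fin fineK ?fin_num_measure // probability_le1.
Qed.

End Expectations.

Arguments passage_seq_cvg {R I d Om P S p} hS x y.

(** * Finiteness, recurrence and the limit *)

Section ShiftedSeries.
Context {R : realType}.
Local Open Scope ring_scope.
Implicit Types u v : fps R.

Lemma shifted_series_le u v (c W : R) m : (forall n, 0 <= v n) ->
  (forall n, u n * c <= v (n + m)%N) -> (forall n, series v n <= W) ->
  forall n, series u n * c <= W.
Proof.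
move=> v0 uv vW n; apply: le_trans (vW (n + m)%N).
rewrite /series /= mulr_suml (@big_cat_nat _ _ _ m 0 (n + m)) ?leq_addl //=.
apply: ler_wpDl; first by rewrite sumr_ge0.
rewrite -{1}[m]add0n big_addn addnK; apply: ler_sum => k _; exact: uv.
Qed.

Lemma fpsM_gt0_term u v n : (forall k, 0 <= u k) -> (forall k, 0 <= v k) ->
  0 < (u * v : fps R) n -> exists2 k, (k <= n)%N & 0 < u k /\ 0 < v (n - k)%N.
Proof.
move=> u0 v0; rewrite fpsME => uv; apply: contrapT => none.
move: uv; rewrite big1 ?ltxx // => k _; apply/eqP; rewrite mulf_eq0.
have [//|uk] := eqVneq (u k) 0; have [//|vk] := eqVneq (v (n - k)%N) 0.
case: none; exists k; first by rewrite -ltnS.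
by rewrite !lt_neqAle !u0 !v0 ![0 == _]eq_sym uk vk.
Qed.

End ShiftedSeries.

Section MainProof.
Context {R : realType} {I : countType} {d : measure_display} {Om : measurableType d}.
Context {P : I -> probability Om R} {S : nat -> Om -> I} {p : I -> I -> R}.
Hypothesis hS : is_markov_chain P S p.
Hypothesis hirr : irreducible P S.

Local Notation T := (trans_seq (p := p)).
Local Notation F := (passage_seq (p := p)).
Local Notation V := (visit_seq (p := p)).
Local Notation hit_prob x y := (fine (P x [set w | (hit S y w < +oo :> \bar R)%E])).

Let T0 x y n : (0 <= T x y n)%R. Proof. exact: taboo_ge0 hS _ _ _ _. Qed.
Let F0 x y n : (0 <= F x y n)%R. Proof. exact: passage_ge0 hS _ _ _. Qed.
Let V0 x y n : (0 <= V x y n)%R. Proof. exact: taboo_ge0 hS _ _ _ _. Qed.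

Lemma irreducible_trans x y : exists n, (0 < T x y n)%R.
Proof. by have [n] := hirr x y; rewrite (prob_trans hS) lte_fin; exists n. Qed.

(** These bounds make [alpha] an ordinary quotient of positive reals. Irreducibility provides a time
    [m] with P_x(T_y = m) > 0, and the inverse of this probability bounds the expectation. *)
Lemma visit_seq_cvg x y : x <> y ->
  exists s : R, [/\ series (V x y) n @[n --> \oo] --> s, (0 < s)%R &
    visits_before P S x y = s%:E].
Proof.
move=> xy; have [n] := irreducible_trans x y; rewrite (trans_seq_passage hS xy).
move=> /(fpsM_gt0_term (F0 x y) (T0 y y)) [m _ [Fm _]].
(* The events [S_k = x, T_y = k + m] are included in the disjoint [T_y = k + m]. *)
have VF k : (series (V x y) k * F x y m <= 1)%R.
  apply: (shifted_series_le (v := F x y) (m := m)) => [||j] //.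
    by move=> j; exact: taboo_passage_le hS _ _ _ _ _.
  exact: passage_seq_series_le1 hS _ _ _.
have [|s Vs] := @nneg_series_cvg _ (V x y) (1 / F x y m) (V0 x y).
  by move=> k; rewrite ler_pdivlMr.
exists s; split=> //; last by rewrite (visits_beforeE hS) -(nneseries_EFin Vs).
(* The visit at time 0 already contributes 1. *)
apply: lt_le_trans (nneg_series_le 1 (V0 x y) Vs).
by rewrite /series /= big_nat1 /visit_seq taboo0 eqxx.
Qed.

(** Every return time is a sum of first-return times, so a common divisor of the latter divides the
    former; strong induction along the renewal equation. *)
Lemma passage_support_gcd x : aperiodic P S ->
  forall e, (forall k, (0 < F x x k)%R -> (e %| k)%N) -> (e %| 1)%N.
Proof.
move=> haper e eF; have [_ gcd1] := haper x; apply: gcd1 => n [_].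
rewrite (prob_trans hS) lte_fin.
elim/ltn_ind: n => -[|n] IH; first by rewrite dvdn0.
rewrite -[taboo _ _ _ _ _]/(T x x n.+1) (trans_seq_renewal hS) fpsDE fps1E add0r.
move=> /(fpsM_gt0_term (F0 x x) (T0 x x)) [k kn [Fk Tk]].
have k0 : (0 < k)%N by case: k Fk {kn Tk} => //; rewrite ltxx.
by rewrite -(subnKC kn) dvdn_addr ?(eF k Fk) // IH // ltn_subrL k0.
Qed.

(** Fixed paths from [x] to [z] and back turn a loop at [z] into a loop at [x] that is longer by
    [m + k]. *)
Lemma trans_seq_bounded_transfer x z : (exists C, forall n, series (T x x) n <= C)%R ->
  exists C, (forall n, series (T z z) n <= C)%R.
Proof.
move=> [C TC]; have [m Tm] := irreducible_trans x z; have [k Tk] := irreducible_trans z x.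
exists (C / (T x z m * T z x k))%R => n; rewrite ler_pdivlMr ?mulr_gt0 //.
apply: (shifted_series_le (v := T x x) (m := (m + k)%N)) => // j.
rewrite mulrA [X in (X * _)%R]mulrC (_ : (j + (m + k) = m + j + k)%N); last by lia.
apply: le_trans (trans_mul_le hS k (m + j)%N x z x); rewrite ler_wpM2r ?T0 //.
exact: trans_mul_le hS _ _ _ _ _.
Qed.

Lemma trans_seq_transient_cvg x : (hit_prob x x < 1)%R ->
  exists s : R, series (T x x) n @[n --> \oo] --> s.
Proof.
move=> h1; apply: (@nneg_series_cvg _ _ (1 / (1 - hit_prob x x)) (T0 x x)) => n.
apply: renewal_series_le (T0 x x) (F0 x x) (trans_seq_renewal hS x) _ _ h1 n => n.
  exact: series_fps1_le1.
exact: nneg_series_le (F0 x x) (passage_seq_cvg hS x x).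
Qed.

(** The negation of [transient] yields a single state with certain return; irreducibility spreads
    the divergence from it to every state. *)
Lemma recurrent_unbounded z x : (1 <= hit_prob z z)%R ->
  ~ (exists C, forall n, series (T x x) n <= C)%R.
Proof.
move=> z1 /trans_seq_bounded_transfer - /(_ z) [C TC].
have [s Ts] := nneg_series_cvg (T0 z z) TC.
apply: renewal_not_summable (F0 z z) (trans_seq_renewal hS z) _ Ts.
have := passage_seq_cvg hS z z; rewrite (_ : hit_prob z z = 1%R) //.
by apply/eqP; rewrite eq_le z1 (prob_hit_fin_le1 hS).
Qed.

Lemma recurrent_hit_return x : ~ (exists C, forall n, series (T x x) n <= C)%R ->
  hit_prob x x = 1%R.
Proof.
move=> unb; apply/eqP; rewrite eq_le (prob_hit_fin_le1 hS) /= leNgt; apply/negP => h1.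
apply: unb; have [s Ts] := trans_seq_transient_cvg h1.
by exists s => n; exact: nneg_series_le (T0 x x) Ts.
Qed.

(** Combining the decompositions, [T x x = V x y + F x y * F y x * T x x] with [V x y] summable. If
    the product of the two hitting probabilities were below 1, [T x x] would have bounded partial
    sums. *)
Lemma recurrent_hit x y : x <> y -> ~ (exists C, forall n, series (T x x) n <= C)%R ->
  hit_prob x y = 1%R /\ hit_prob y x = 1%R.
Proof.
move=> xy unb; have [s [Vs _ _]] := visit_seq_cvg xy.
have prod1 : (1 <= hit_prob x y * hit_prob y x)%R.
  rewrite leNgt; apply/negP => h1; apply: unb.
  exists (s / (1 - hit_prob x y * hit_prob y x))%R => n.
  apply: (renewal_series_le (h := (F x y * F y x)%R) (w := V x y) (T0 x x) _ _ _ _ h1) => [||k|k].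
  - exact: nneg_fpsM.
  - by rewrite -mulrA -(trans_seq_passage hS) -?(trans_seq_detour hS) // => /esym.
  - exact: nneg_series_le (V0 x y) Vs.
  apply: nneg_series_le; first exact: nneg_fpsM.
  exact: series_fpsM (F0 x y) (passage_seq_cvg hS x y) (passage_seq_cvg hS y x).
have := prob_hit_fin_le1 hS x y; have := prob_hit_fin_le1 hS y x.
have := prob_hit_fin_ge0 (P := P) (S := S) x y; have := prob_hit_fin_ge0 (P := P) (S := S) y x.
set a := hit_prob x y in prod1 *; set b := hit_prob y x in prod1 *.
by move=> b0 a0 b1 a1; split; nra.
Qed.

Lemma potE N x y : pot P S N x y = (series (T x x) N - series (T y x) N)%:E.
Proof. by rewrite /pot !(greenNE hS) EFinB. Qed.

Lemma pot_ge0 N x y : 0 <= pot P S N x y.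
Proof.
rewrite potE lee_fin; have [->|/eqP yx] := eqVneq y x; first by rewrite subrr.
exact: potential_ge0 (T0 x x) (trans_seq_passage hS yx) (passage_seq_series_le1 hS y x).
Qed.

Lemma pot_cvg x y : aperiodic P S -> x <> y ->
  exists l : R, (fun N => pot P S N x y + alpha P S x y * pot P S N y x)
    @ \oo --> l%:E /\ l%:E = limit_value P S x y.
Proof.
move=> haper xy; have yx : y <> x by move=> /esym.
have [Vx [Vx_cvg Vx0 VxE]] := visit_seq_cvg xy.
have [Vy [Vy_cvg Vy0 VyE]] := visit_seq_cvg yx.
have potsE : (fun N => pot P S N x y + alpha P S x y * pot P S N y x) =
    EFin \o (fun N => (series (T x x) N - series (T y x) N) +
      Vx / Vy * (series (T y y) N - series (T x y) N))%R.
  apply/funext => N.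
  by rewrite !potE /alpha VxE VyE inver gt_eqF //= -!EFinM -EFinD.
have lim_EFin (l : R) : (series (T x x) N - series (T y x) N +
      Vx / Vy * (series (T y y) N - series (T x y) N))%R
      @[N --> \oo] --> l ->
    (fun N => pot P S N x y + alpha P S x y * pot P S N y x) @ \oo --> l%:E.
  by rewrite potsE => h; apply: cvg_EFin => //; exact: nearW.
rewrite /limit_value /ind_transient; case: asboolP => [tr|ntr].
  have hlt z : (hit_prob z z < 1)%R.
    by rewrite -lte_fin fineK ?tr // fin_num_measure //; exact: measurable_hit_fin hS z.
  have [Gx Gx_cvg] := trans_seq_transient_cvg (hlt x).
  have [Gy Gy_cvg] := trans_seq_transient_cvg (hlt y).
  eexists; split; first apply: lim_EFin.
    exact: (transient_potential_cvg (F0 x y) (F0 y x) (trans_seq_passage hS yx)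
      (trans_seq_passage hS xy) (trans_seq_detour hS x y) (trans_seq_detour hS y x) Vx_cvg Vy_cvg
      (passage_seq_cvg hS x y) (passage_seq_cvg hS y x) Vy0 Gx_cvg Gy_cvg).
  rewrite VxE (greenE hS) (nneseries_EFin Gx_cvg) !(prob_hit_infty hS) mul1e.
  by rewrite EFinD !EFinM.
have [z z1] : exists z, (1 <= hit_prob z z)%R.
  apply: contrapT => no; apply: ntr => z; rewrite ltNge; apply/negP => z1.
  apply: no; exists z; rewrite -lee_fin fineK // fin_num_measure //.
  exact: measurable_hit_fin hS z.
have unb w := @recurrent_unbounded _ w z1.
have [fxy fyx] := recurrent_hit xy (unb x).
(* The indicator is 0 here, and [0 * +oo = 0] discards the infinite Green function. *)
exists Vx; split; last by rewrite VxE !mul0e adde0.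
have ret u : series (F u u) n @[n --> \oo] --> (1 : R)%R.
  by rewrite -(recurrent_hit_return (unb u)); exact: (passage_seq_cvg hS u u).
apply: lim_EFin.
exact: (recurrent_potential_cvg (T0 x x) (T0 y y) (F0 x y) (F0 y x) (V0 x y) (V0 y x)
  (trans_seq_passage hS yx) (trans_seq_passage hS xy) (trans_seq_detour hS x y) (trans_seq_detour hS y x)
  Vx_cvg Vy_cvg (passage_seq_cvg hS x y) (passage_seq_cvg hS y x) Vy0 fxy fyx (F0 x x) (F0 y y)
  (trans_seq_renewal hS x) (trans_seq_renewal hS y) (ret x) (ret y)
  (passage_support_gcd haper) (passage_support_gcd haper)).
Qed.

End MainProof.

Theorem lemma4p2 (R : realType) (I : countType) (d : measure_display)
    (Om : measurableType d) (P : I -> probability Om R) (S : nat -> Om -> I)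
    (p : I -> I -> R) (hS : is_markov_chain P S p)
    (hirr : irreducible P S) (haper : aperiodic P S) :
  (forall (x y : I) (N : nat), (1 <= N)%N -> 0 <= pot P S N x y) /\
  (forall x y : I, x <> y ->
    exists l : R,
      (fun N : nat => pot P S N x y + alpha P S x y * pot P S N y x)
        @ \oo --> l%:E /\
      l%:E = limit_value P S x y).
Proof.
split=> [x y N _|x y xy]; first exact: pot_ge0 hS N x y.
exact: (pot_cvg hS hirr haper xy).
Qed.
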